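(* Let $n$ be an odd positive integer with squarefree part $t$. Let $p\equiv 3 \pmod 4$ be a prime number such that the squarefree part $s$ of $p+1$ satisfies $s>1$. Suppose there exists an odd prime $q$ such that (i) $q$ divides $t$, (ii) $\left(\frac{s}{q}\right)=1$, and (iii) $\left(\frac{-p}{q}\right)=-1$. Then $\mathcal{H}(n,X_p)$ is empty.
   Context: For a set $X$ of complex numbers of modulus $1$, $\mathcal{H}(n,X)$ denotes the set of $n\times n$ matrices $M$ with all entries in $X$ satisfying $MM^{\ast}=nI_n$, where $M^{\ast}$ is the conjugate transpose. $X_p=\left\{\frac{\pm 1\pm\sqrt{-p}}{\sqrt{p+1}}\right\}$ (all four choices of signs). The squarefree part of a positive integer $N$ is the unique squarefree positive integer $d$ such that $N/d$ is a perfect square. $\left(\frac{a}{q}\right)$ denotes the Legendre symbol. *)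

(* Defs.v *)
From HB Require Import structures.
From mathcomp Require Import all_boot all_order all_algebra.
From mathcomp Require Import classical_sets reals.
From mathcomp Require Import complex.

Set Implicit Arguments.
Unset Strict Implicit.
Unset Printing Implicit Defensive.

Import Order.TTheory GRing.Theory Num.Theory.

Local Open Scope ring_scope.
Local Open Scope sesquilinear_scope.

Definition squarefree (d : nat) : Prop :=
  (0 < d)%N /\ forall m : nat, (m ^ 2 %| d)%N -> m = 1%N.

Definition squarefree_part (N d : nat) : Prop :=
  squarefree d /\ exists m : nat, N = (d * m ^ 2)%N.

(* The Legendre symbol (a/q); it is meant for q an odd prime. *)
Definition legendre (a : int) (q : nat) : int :=
  if (q %| a)%Z then 0
  else if [exists x : 'I_q, (q %| (x%:Z ^+ 2 - a))%Z] then 1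
  else -1.

Section ComplexHadamard.
Variable C : numClosedFieldType.

(* Meant for sets X of complex numbers of modulus 1. *)
Definition Hadamard (n : nat) (X : set C) : set 'M[C]_n :=
  [set M : 'M[C]_n | (forall i j, X (M i j)) /\ M *m M ^t* = n%:R%:M]%classic.

Definition Xset (p : nat) : set C :=
  [set ((-1) ^+ a + (-1) ^+ b * sqrtC (- p%:R)) / sqrtC (p.+1)%:R
    | a in [set: bool] & b in [set: bool]]%classic.

Lemma Xset_norm1 p z : Xset p z -> `|z| = 1.
Proof.
have sp1_gt0 : 0 < sqrtC (p.+1%:R : C) by rewrite sqrtC_gt0 ltr0n.
have sq_norm : `|sqrtC (- p%:R : C)| ^+ 2 = p%:R.
  by rewrite -normrX sqrtCK normrN normr_nat.
have conjS : (sqrtC (- p%:R : C))^* = - sqrtC (- p%:R).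
  have [->|s0] := eqVneq (sqrtC (- p%:R : C)) 0; first by rewrite conjC0 oppr0.
  by apply: (mulfI s0); rewrite -normCK sq_norm mulrN -expr2 sqrtCK opprK.
case=> a _ [b _ <-]; apply/eqP.
rewrite -sqrp_eq1 // normrM normfV (gtr0_norm sp1_gt0) expr_div_n sqrtCK normCK.
rewrite rmorphD rmorphM /= !rmorph_sign conjS mulrN [(_ + _) * _]mulrC -subr_sqr exprMn.
by rewrite !sqrr_sign mul1r sqrtCK opprK -natr1 addrC divff // natr1 pnatr_eq0.
Qed.

End ComplexHadamard.

(* Main.v *)
(** Clearing the denominator, a matrix [M] of H(n, X_p) becomes a matrix [N] with
    entries in Z[sqrt(-p)] and [N N^* = n (p + 1) I].  Taking determinants,
    [(n (p + 1))^n] is a norm [x^2 + p y^2].  As [-p] is not a square modulo [q],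
    such a norm has even [q]-adic valuation, whereas that of [(n (p + 1))^n] is
    odd: [n] is odd, [q] divides [t] exactly once, and [q] does not divide [s]. *)
Require Import Defs.
From mathcomp Require Import all_boot all_order all_algebra.
From mathcomp Require Import classical_sets reals.
From mathcomp Require Import complex.
From mathcomp Require Import ring zify.

Import Order.TTheory GRing.Theory Num.Theory.

Local Open Scope ring_scope.

Lemma squarefree_logn d q : squarefree d -> prime q -> (q %| d)%N -> logn q d = 1%N.
Proof.
move=> [d_gt0 sqf] q_pr qd; apply/eqP; rewrite eqn_leq.
rewrite (_ : (0 < logn q d)%N); last by rewrite logn_gt0 mem_primes q_pr d_gt0 qd.
rewrite andbT leqNgt -pfactor_dvdn //; apply/negP => /sqf q1.
by rewrite q1 in q_pr.
Qed.

(** The square cofactor has even valuation, and [d] contributes 1 or 0. *)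
Lemma odd_logn_squarefree_part N d q : (0 < N)%N -> squarefree_part N d ->
  prime q -> odd (logn q N) = (q %| d)%N.
Proof.
move=> N_gt0 [sqf [m Nm]] q_pr; move: N_gt0; rewrite Nm muln_gt0 => /andP[d0 m0].
rewrite lognM // lognX oddD oddM addbF.
have [qd|qd] := boolP (q %| d)%N; first by rewrite (squarefree_logn _ _ sqf).
by rewrite lognE d0 q_pr (negPf qd).
Qed.

Lemma legendre1_ndvd (s q : nat) : legendre s%:Z q = 1 -> ~~ (q %| s)%N.
Proof. by rewrite /legendre dvdzE /=; case: ifP. Qed.

(** The form [x ^ 2 + p * y ^ 2] is anisotropic modulo [q]: a zero with [y] invertible would exhibit
    [-p] as a square. *)
Lemma legendreN1_dvd (p q x y : nat) : prime q -> legendre (- p%:Z) q = -1 ->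
  (q %| x ^ 2 + p * y ^ 2)%N -> (q %| x)%N && (q %| y)%N.
Proof.
move=> q_pr leg qxy.
have qy : (q %| y)%N.
  apply: contraT => qNy; have q_gt0 := prime_gt0 q_pr.
  have y_gt0 : (0 < y)%N by rewrite lt0n; apply: contraNneq qNy => ->; rewrite dvdn0.
  have /eqP gcd1 : coprime y q by rewrite coprime_sym prime_coprime.
  case: (egcdnP q y_gt0) => u v; rewrite gcd1 => uy _.
  (* As [u] inverts [y] modulo [q], [u * x] is a square root of [-p]. *)
  suff root : [exists z : 'I_q, (q %| (z%:Z ^+ 2 - - p%:Z))%Z].
    by move: leg; rewrite /legendre root; case: ifP.
  apply/existsP; exists (Ordinal (ltn_pmod (u * x) q_gt0)) => /=.
  have [m xyE] := dvdnP qxy; set z := (u * x %% q)%N.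
  have zE := divn_eq (u * x) q; rewrite -/z in zE.
  set k := (u * x %/ q)%N in zE.
  (* The witness is [(z ^ 2 + p) / q], expanded with [z = u * x - k * q],
     [x ^ 2 = m * q - p * y ^ 2] and [u * y = v * q + 1]. *)
  apply/dvdzP; exists (k%:Z ^+ 2 * q%:Z - 2 * k%:Z * u%:Z * x%:Z
    + u%:Z ^+ 2 * m%:Z - p%:Z * (v%:Z ^+ 2 * q%:Z + 2 * v%:Z)).
  have -> : z%:Z = u%:Z * x%:Z - k%:Z * q%:Z by lia.
  have xyZ : m%:Z * q%:Z = x%:Z ^+ 2 + p%:Z * y%:Z ^+ 2 by lia.
  have uyZ : v%:Z * q%:Z = u%:Z * y%:Z - 1 by lia.
  transitivity (k%:Z ^+ 2 * q%:Z ^+ 2 - 2 * k%:Z * u%:Z * x%:Z * q%:Z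
    + u%:Z ^+ 2 * (m%:Z * q%:Z) - p%:Z * ((v%:Z * q%:Z) ^+ 2 + 2 * (v%:Z * q%:Z))).
    by rewrite xyZ uyZ; ring.
  by ring.
have := qxy; rewrite dvdn_addl ?Euclid_dvdX ?andbT // => [->//|].
by rewrite dvdn_mull // dvdn_exp.
Qed.

(** Infinite descent on [x + y]: if [q] divides the norm, it divides both [x] and [y], and removing
    it from both lowers the valuation by 2. *)
Lemma odd_logn_norm (p q x y : nat) : prime q -> legendre (- p%:Z) q = -1 ->
  odd (logn q (x ^ 2 + p * y ^ 2)) = false.
Proof.
move=> q_pr leg; have q_gt1 := prime_gt1 q_pr.
have [k] := ubnP (x + y)%N; elim: k x y => // k IHk x y lxy.
(* A zero norm has valuation 0 by convention; setting it aside keeps [x' + y'] positive below, so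
   that the descent is strict. *)
have [->|xy_neq0] := eqVneq (x ^ 2 + p * y ^ 2)%N 0%N; first by rewrite logn0.
have [qxy|qNxy] := boolP (q %| x ^ 2 + p * y ^ 2)%N; last first.
  by rewrite lognE q_pr (negPf qNxy) andbF.
have /andP[/dvdnP[x' xE] /dvdnP[y' yE]] := legendreN1_dvd _ _ _ _ q_pr leg qxy.
have E : (x ^ 2 + p * y ^ 2 = q ^ 2 * (x' ^ 2 + p * y' ^ 2))%N.
  by rewrite xE yE; ring.
move: xy_neq0; rewrite E -lt0n muln_gt0 => /andP[q2 r_gt0].
rewrite lognM // lognX oddD oddM /=; apply: IHk.
have : (0 < x' + y')%N.
  by rewrite lt0n; apply: contraTneq r_gt0 => /eqP; rewrite addn_eq0 => /andP[/eqP-> /eqP->]; rewrite muln0.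
nia.
Qed.

(** A root [r] of [-p] times its conjugate is its squared modulus [p], which is [- r ^ 2]; a nonzero
    [r] cancels. *)
Lemma conjC_sqrtCN_nat {C : numClosedFieldType} (p : nat) :
  (sqrtC (- p%:R : C))^* = - sqrtC (- p%:R).
Proof.
have [->|r0] := eqVneq (sqrtC (- p%:R : C)) 0; first by rewrite conjC0 oppr0.
apply: (mulfI r0); rewrite -normCK -normrX sqrtCK normrN normr_nat.
by rewrite mulrN -expr2 sqrtCK opprK.
Qed.

Section QuadraticInteger.
Variables (C : numClosedFieldType) (p : nat).
Let r : C := sqrtC (- p%:R).

(** The ring Z[sqrt(-p)] as a subset of [C]. *)
Definition quad_int (z : C) := exists x y : int, z = x%:~R + y%:~R * r.

Lemma quad_int_sign (b : bool) : quad_int ((-1) ^+ b).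
Proof. by exists ((-1) ^+ b), 0; rewrite mul0r addr0 rmorph_sign. Qed.

Lemma quad_intD z1 z2 : quad_int z1 -> quad_int z2 -> quad_int (z1 + z2).
Proof.
move=> [x1 [y1 ->]] [x2 [y2 ->]]; exists (x1 + x2), (y1 + y2).
by rewrite !rmorphD /=; ring.
Qed.

Lemma quad_intM z1 z2 : quad_int z1 -> quad_int z2 -> quad_int (z1 * z2).
Proof.
move=> [x1 [y1 ->]] [x2 [y2 ->]].
exists (x1 * x2 - p%:Z * (y1 * y2)), (x1 * y2 + y1 * x2).
have r2 : r ^+ 2 = - p%:R by rewrite sqrtCK.
transitivity (x1%:~R * x2%:~R + y1%:~R * y2%:~R * r ^+ 2
              + (x1%:~R * y2%:~R + y1%:~R * x2%:~R) * r); first by ring.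
by rewrite r2 rmorphB !rmorphD !rmorphM /= -pmulrn; ring.
Qed.

(** The Leibniz formula uses only sums and products of entries and signs. *)
Lemma quad_int_det n (N : 'M[C]_n) :
  (forall i j, quad_int (N i j)) -> quad_int (\det N).
Proof.
move=> hN; rewrite /determinant; apply: big_ind => [||s _].
- by exists 0, 0; rewrite mul0r addr0.
- exact: quad_intD.
apply: quad_intM; first exact: quad_int_sign.
by apply: big_ind => // [|]; [exact: (quad_int_sign false) | exact: quad_intM].
Qed.

Lemma quad_int_norm z : quad_int z ->
  exists x y : nat, z * z^* = (x ^ 2 + p * y ^ 2)%:R.
Proof.
move=> [x [y ->]]; exists `|x|%N, `|y|%N.
have sq (a : int) : (`|a| ^ 2)%:R = (a%:~R : C) ^+ 2.
  by rewrite natrX natr_absz intr_norm real_normK ?realz.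
rewrite rmorphD rmorphM /= !rmorph_int conjC_sqrtCN_nat -/r natrD natrM !sq.
have r2 : r ^+ 2 = - p%:R by rewrite sqrtCK.
transitivity (x%:~R ^+ 2 - y%:~R ^+ 2 * r ^+ 2); first by ring.
by rewrite r2; ring.
Qed.

End QuadraticInteger.

(** Scaling by [w], the square root of [p + 1], puts the entries in Z[sqrt(-p)]; the norm of the
    determinant of [w *: M] is then computed in two ways. *)
Lemma Hadamard_Xset_norm (C : numClosedFieldType) (n p : nat) (M : 'M[C]_n) :
  @Hadamard C n (@Xset C p) M ->
  exists x y : nat, ((n * p.+1) ^ n = x ^ 2 + p * y ^ 2)%N.
Proof.
move=> [MX MM]; pose w : C := sqrtC p.+1%:R.
have w_gt0 : 0 < w by rewrite sqrtC_gt0 ltr0n.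
have hN i j : quad_int C p ((w *: M) i j).
  rewrite mxE; have [a _ [b _ <-]] := MX i j.
  rewrite mulrC divfK ?gt_eqF //; apply: quad_intD; first exact: quad_int_sign.
  by exists 0, ((-1) ^+ b); rewrite add0r rmorph_sign.
have [x [y xy]] := quad_int_norm _ _ _ (quad_int_det _ _ _ _ hN).
exists x, y; apply/eqP; rewrite -(eqr_nat C) -xy; apply/eqP.
have := congr1 determinant MM; rewrite det_mulmx det_scalar det_map_mx det_tr => dM.
(* The factor [w ^+ n] is real, so it equals its conjugate and contributes [(p + 1) ^ n]. *)
rewrite detZ rmorphM mulrACA dM /= (CrealP _) ?gtr0_real ?exprn_gt0 //.
by rewrite -exprMn -expr2 sqrtCK -exprMn natrX natrM mulrC.
Qed.

Theorem theorem13 (R : realType) (n t p s : nat)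
    (n_odd : odd n) (n_t : squarefree_part n t)
    (p_prime : prime p) (p_mod4 : p = 3 %[mod 4])
    (p1_s : squarefree_part p.+1 s) (s_gt1 : (1 < s)%N)
    (q_ex : exists q : nat,
       [/\ prime q, odd q, (q %| t)%N,
           legendre s%:Z q = 1 & legendre (- p%:Z) q = -1]) :
  @Hadamard R[i] n (@Xset R[i] p) = set0.
Proof.
rewrite -subset0 => M /Hadamard_Xset_norm[x [y xy]].
have [q [q_pr _ qt /legendre1_ndvd qs leg]] := q_ex.
have n_gt0 := odd_gt0 n_odd.
have := odd_logn_norm p q x y q_pr leg.
(* As [n] is odd, the [n]-th power keeps the parity of the valuation of [n * p.+1], which is odd by
   [qt] and [qs]. *)
rewrite -xy lognX oddM n_odd lognM // oddD.
by rewrite (odd_logn_squarefree_part _ _ _ _ n_t) // (odd_logn_squarefree_part _ _ _ _ p1_s) // qt (negPf qs).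
Qed.
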